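(* Let $T_1$ and $T_2$ be two loopy tournaments in $\mathcal{T}^{\ell}(R)$. Then $T_1$ can be brought to $T_2$ by a sequence of $3$-cycle switches and edge-loop switches where each switch produces a loopy tournament in $\mathcal{T}^{\ell}(R)$.
   Context: A loopy tournament of order $n$ is an $n\times n$ $(0,1)$-matrix $T=[t_{ij}]$ with $t_{ij}=1-t_{ji}$ for $i\ne j$, where each $t_{ii}$ may be $0$ or $1$. Its score vector is the vector of row sums (diagonal entries included), and $\mathcal{T}^{\ell}(R)$ denotes the set of all loopy tournaments with score vector $R=(r_1,\ldots,r_n)$. A $3$-cycle switch $\bigtriangleup_{i,j,k}$, for distinct $i,j,k$, applies to $T$ when $t_{ij}=t_{jk}=t_{ki}=1$ (so $t_{ji}=t_{kj}=t_{ik}=0$) and replaces these six entries by $t_{ij}=t_{jk}=t_{ki}=0$ and $t_{ji}=t_{kj}=t_{ik}=1$, leaving all other entries (including the diagonal) unchanged. An edge-loop switch, for distinct $i,j$, applies to $T$ when $t_{ii}=0$, $t_{ij}=1$, $t_{ji}=0$, $t_{jj}=1$, and replaces these four entries by $t_{ii}=1$, $t_{ij}=0$, $t_{ji}=1$, $t_{jj}=0$, leaving all other entries unchanged. *)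

(* Defs.v *)
From mathcomp Require Import all_boot all_order all_algebra.
Set Implicit Arguments.
Unset Strict Implicit.
Unset Printing Implicit Defensive.
Import GRing.Theory.
Local Open Scope ring_scope.

(* The diagonal is constrained only by the first conjunct. *)
Definition loopy_tournament (n : nat) (T : 'M[int]_n) : bool :=
  [forall i, forall j, (T i j == 0) || (T i j == 1)]
  && [forall i, forall j, (i != j) ==> (T i j == 1 - T j i)].

Definition score_vector (n : nat) (T : 'M[int]_n) : 'rV[int]_n :=
  \row_i \sum_j T i j.

Definition loopy_tournaments (n : nat) (R : 'rV[int]_n) : {pred 'M[int]_n} :=
  [pred T | loopy_tournament T && (score_vector T == R)].

(* These two functions only overwrite entries; when a switch may be applied is
   part of [cycle_switch_step] and [edge_loop_switch_step]. *)
Definition cycle_switch (n : nat) (i j k : 'I_n) (T : 'M[int]_n) : 'M[int]_n :=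
  \matrix_(a, b)
    if (a, b) \in [:: (i, j); (j, k); (k, i)] then 0
    else if (a, b) \in [:: (j, i); (k, j); (i, k)] then 1
    else T a b.

Definition edge_loop_switch (n : nat) (i j : 'I_n) (T : 'M[int]_n) : 'M[int]_n :=
  \matrix_(a, b)
    if (a, b) \in [:: (i, j); (j, j)] then 0
    else if (a, b) \in [:: (i, i); (j, i)] then 1
    else T a b.

Definition cycle_switch_step (n : nat) : rel 'M[int]_n := fun T T' =>
  [exists i, exists j, exists k,
    [&& i != j, j != k, k != i,
        T i j == 1, T j k == 1, T k i == 1,
        T j i == 0, T k j == 0, T i k == 0
      & T' == cycle_switch i j k T]].

Definition edge_loop_switch_step (n : nat) : rel 'M[int]_n := fun T T' =>
  [exists i, exists j,
    [&& i != j, T i i == 0, T i j == 1, T j i == 0, T j j == 1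
      & T' == edge_loop_switch i j T]].

Definition switch_step (n : nat) : rel 'M[int]_n := fun T T' =>
  cycle_switch_step T T' || edge_loop_switch_step T T'.

(* Main.v *)
Require Import Defs.
From mathcomp Require Import all_boot all_order all_algebra.

(** A loopy tournament of order [n] is an ordinary tournament with one more
player [None]: read the loop at [i] as the game between [i] and [None], won by
[i] exactly when [T i i = 1].  Under this reading the score of [i] counts all
games of [Some i], a 3-cycle switch reverses a directed triangle that avoids
[None], and an edge-loop switch at [i, j] reverses the directed triangle
[Some i -> Some j -> None -> Some i].  The score of [None] is determined by the
other scores, because every tournament on the same players has the same number
of arcs ([card_out_last_vertex]).  Hence the theorem reduces to the fact that
two tournaments [A], [B] with equal scores are connected by reversals of
directed triangles ([cycle_reversal_connect]).

That fact is proved by induction on the number of arcs in [A :\: B], the arcs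
of [A] that [B] orients the other way.  If an arc of [A :\: B] ends at [b],
then equality of scores at [b] forces another arc of [A :\: B] to start at [b]
([setD_arc_next]).  A nonempty finite irreflexive relation with this property
is not transitive ([intransitive_arcs]): there are [a -> b -> c] in [A :\: B]
such that [a -> c] is not in [A :\: B].  So either [c -> a] in [A], and [A]
has the directed triangle [a, b, c]; or [a -> c] in both tournaments, and [B]
has the directed triangle [c, b, a].  Reversing this triangle corrects two or
three arcs and spoils at most one, so the difference shrinks.  In the second
case it is [B] that moves, which is harmless since reversals are symmetric. *)

Local Open Scope ring_scope.

Set Implicit Arguments.
Unset Strict Implicit.
Unset Printing Implicit Defensive.
Import GRing.Theory.

(** * Tournaments as sets of arcs *)

Section Tournaments.
Local Open Scope nat_scope.
Variable V : finType.
Implicit Types (A B : {set V * V}) (X : {set V}) (x y a b c : V).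

Definition is_tournament A :=
  [forall x, forall y, ((x, y) \in A) == (x != y) && ((y, x) \notin A)].

Definition out A x := [set y | (x, y) \in A].

(** For a tournament in which [a], [b], [c] form a directed triangle, reversing
all arcs inside [[set a; b; c]] is the 3-cycle switch.  This description does
not depend on which way the triangle turns, and makes the operation an
involution. *)
Definition reverse_in X A :=
  [set p | if (p.1 \in X) && (p.2 \in X) then (p.2, p.1) \in A else p \in A].

Definition three_cycle A a b c :=
  [&& (a, b) \in A, (b, c) \in A & (c, a) \in A].

Definition cycle_reversal : rel {set V * V} := fun A B =>
  is_tournament A &&
  [exists a, exists b, exists c,
     three_cycle A a b c && (B == reverse_in [set a; b; c] A)].

Lemma is_tournamentP A :
  reflect (forall x y, ((x, y) \in A) = (x != y) && ((y, x) \notin A))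
          (is_tournament A).
Proof. by apply: (iffP 'forall_forallP) => tA x y; apply/eqP. Qed.

Lemma cycle_reversalP A B :
  reflect (is_tournament A /\ exists a b c,
             three_cycle A a b c /\ B = reverse_in [set a; b; c] A)
          (cycle_reversal A B).
Proof.
apply: (iffP andP) => [[-> /existsP[a /existsP[b /existsP[c]]]]|].
  by case/andP=> cA /eqP->; split=> //; exists a, b, c.
case=> -> [a [b [c [cA ->]]]]; split=> //.
by apply/existsP; exists a; apply/existsP; exists b; apply/existsP; exists c;
  rewrite cA eqxx.
Qed.

Lemma tournament_irr A x : is_tournament A -> ((x, x) \in A) = false.
Proof. by move/is_tournamentP->; rewrite eqxx. Qed.

Lemma tournament_asym A x y :
  is_tournament A -> (x, y) \in A -> ((y, x) \in A) = false.
Proof. by move/is_tournamentP=> tA; rewrite tA => /andP[_ /negPf]. Qed.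

Lemma tournament_total A x y :
  is_tournament A -> x != y -> (x, y) \notin A -> (y, x) \in A.
Proof.
by move/is_tournamentP=> tA nxy; rewrite (tA y) eq_sym nxy.
Qed.

Lemma tournament_neq A x y : is_tournament A -> (x, y) \in A -> x != y.
Proof. by move/is_tournamentP->; case/andP. Qed.

Lemma in_reverse_in X A x y :
  ((x, y) \in reverse_in X A) =
  if (x \in X) && (y \in X) then (y, x) \in A else (x, y) \in A.
Proof. by rewrite inE. Qed.

(** * Reversing directed triangles *)

Lemma reverse_inK X : involutive (reverse_in X).
Proof.
move=> A; apply/setP=> -[x y]; rewrite !in_reverse_in.
by case: (x \in X); case: (y \in X).
Qed.

Lemma reverse_in_tournament X A :
  is_tournament A -> is_tournament (reverse_in X A).
Proof.
move/is_tournamentP=> tA; apply/is_tournamentP=> x y; rewrite !in_reverse_in.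
by rewrite (andbC (y \in X)); case: ifP => _; rewrite tA // eq_sym.
Qed.

Lemma three_cycle_rot A a b c : three_cycle A a b c = three_cycle A b c a.
Proof. by rewrite /three_cycle andbC -andbA. Qed.

Lemma set3_rot a b c : [set a; b; c] = [set b; c; a].
Proof. by rewrite -setUA setUC. Qed.

Lemma cycle_reversal_sym : symmetric cycle_reversal.
Proof.
suff sub A B : cycle_reversal A B -> cycle_reversal B A.
  by move=> A B; apply/idP/idP; apply: sub.
case/cycle_reversalP=> tA [a [b [c [/and3P[ab bc ca] ->]]]].
apply/cycle_reversalP; split; first exact: reverse_in_tournament.
exists c, b, a; split.
  by rewrite /three_cycle !in_reverse_in !inE !eqxx !orbT /= ab bc ca.
rewrite -[LHS](reverse_inK [set a; b; c]); congr (reverse_in _ _).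
by apply/setP=> z; rewrite !inE orbC orbA orbAC.
Qed.

(** On a directed triangle [a -> b -> c -> a] the vertex [a] loses the
out-neighbour [b] and gains [c]. *)
Lemma card_out_three_cycle_vertex A a b c : is_tournament A ->
  three_cycle A a b c ->
  #|out (reverse_in [set a; b; c] A) a| = #|out A a|.
Proof.
move=> tA /and3P[ab bc ca].
have neq_bc := tournament_neq tA bc.
have -> : out (reverse_in [set a; b; c] A) a = c |: (out A a :\ b).
  apply/setP=> y; rewrite !inE /= eqxx /=.
  have [->|nya] := eqVneq y a.
    by rewrite !(tournament_irr _ tA) [a == c]eq_sym
      (negPf (tournament_neq tA ca)) andbF.
  have [->|nyb] := eqVneq y b.
    by rewrite (negPf neq_bc) (tournament_asym tA ab).
  by have [->|nyc] := eqVneq y c; rewrite /= ?ca.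
rewrite cardsU1 (cardsD1 b (out A a)) !inE (tournament_asym tA ca) ab.
by rewrite andbF.
Qed.

(** The triangle can be rotated to start at any of its vertices, so only one of
them has to be examined. *)
Lemma card_out_cycle_reversal A B x :
  cycle_reversal A B -> #|out B x| = #|out A x|.
Proof.
case/cycle_reversalP=> tA [a [b [c [cA ->]]]].
have [->|nxa] := eqVneq x a; first exact: card_out_three_cycle_vertex.
have [->|nxb] := eqVneq x b.
  by rewrite set3_rot card_out_three_cycle_vertex // -three_cycle_rot.
have [->|nxc] := eqVneq x c.
  by rewrite -set3_rot card_out_three_cycle_vertex // three_cycle_rot.
by congr #|pred_of_set _|; apply/setP=> y;
  rewrite !inE /= (negPf nxa) (negPf nxb) (negPf nxc).
Qed.

(** * Comparing two tournaments *)

(** If [e] were transitive, take an arc [a -> b] whose endpoint has the fewest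
successors and a successor [c] of [b]: all successors of [c] are successors of
[b], while [c] itself is lost, against minimality. *)
Lemma intransitive_arcs (e : rel V) x y :
  irreflexive e -> (forall a b, e a b -> exists c, e b c) -> e x y ->
  exists a b c, [/\ e a b, e b c & ~~ e a c].
Proof.
move=> irr_e next_e exy; pose succs b := [set z | e b z].
have [[a b] /= eab min_b] :=
  @arg_minnP _ (x, y) (fun p => e p.1 p.2) (fun p => #|succs p.2|) exy.
have [c ebc] := next_e _ _ eab.
have /subsetPn[z] : ~~ (succs c \subset succs b).
  apply: contraL (min_b (b, c) ebc) => sub_cb; rewrite -ltnNge.
  apply/proper_card/properP; split=> //.
  by exists c; rewrite inE ?irr_e.
by rewrite !inE => ecz nebz; exists b, c, z.
Qed.

Lemma card_setD_shrink A B (C : {set V * V}) a b c :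
  (a, b) \in A :\: B -> (b, c) \in A :\: B ->
  (a, b) != (b, c) -> C \subset (a, c) |: (A :\: B) :\ (a, b) :\ (b, c) ->
  #|C| < #|A :\: B|.
Proof.
move=> dab dbc nabc /subset_leq_card/leq_ltn_trans; apply.
rewrite cardsU1 (cardsD1 (a, b) (A :\: B)) (cardsD1 (b, c) (_ :\ (a, b))) dab.
rewrite (_ : (b, c) \in _ :\ _); last by rewrite in_setD1 eq_sym nabc.
by rewrite !add1n ltnS -add1n leq_add2r; case: (_ \notin _).
Qed.

Lemma setD_tournament_arc A B x y :
  is_tournament A -> is_tournament B ->
  ((x, y) \in A :\: B) = ((x, y) \in A) && ((y, x) \in B).
Proof.
move=> tA tB; rewrite inE andbC; case: (boolP (_ \in A)) => //= xy.
by rewrite (is_tournamentP _ tB y x) eq_sym (tournament_neq tA xy).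
Qed.

Lemma setD_tournament_eq0 A B :
  is_tournament A -> is_tournament B -> A :\: B = set0 -> A = B.
Proof.
move=> tA tB /eqP; rewrite setD_eq0 => /subsetP sAB.
apply/eqP; rewrite eqEsubset; apply/andP; split; apply/subsetP=> // -[x y] xyB.
apply: contraFT (tournament_asym tB xyB) => nxy; rewrite sAB //.
by apply: tournament_total nxy; rewrite // (tournament_neq tB xyB).
Qed.

(** The vertex [a] beats [b] in [A] and loses to [b] in [B].  The out-neighbours
of [b] in [A] are as many as in [B] but miss [a], so they are not all among
those in [B]. *)
Lemma setD_arc_next A B a b :
  is_tournament A -> is_tournament B -> #|out A b| = #|out B b| ->
  (a, b) \in A :\: B -> exists c, (b, c) \in A :\: B.
Proof.
move=> tA tB eq_out; rewrite setD_tournament_arc // => /andP[ab ba].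
case: (boolP (out A b \subset out B b)) => [sAB|/subsetPn[c]]; last first.
  by rewrite !inE => bc nbc; exists c; rewrite inE nbc.
have /eqP/setP/(_ a) : out A b == out B b by rewrite eqEcard sAB eq_out leqnn.
by rewrite !inE ba (tournament_asym tA ab).
Qed.

Lemma setD_tournament_arcC A B x y :
  is_tournament A -> is_tournament B ->
  ((x, y) \in A :\: B) = ((y, x) \in B :\: A).
Proof. by move=> tA tB; rewrite !setD_tournament_arc // andbC. Qed.

(** Both sides count the games decided differently in [A] and [B], so reversing
each arc exchanges them. *)
Lemma card_setD_tournamentC A B :
  is_tournament A -> is_tournament B -> #|A :\: B| = #|B :\: A|.
Proof.
move=> tA tB; rewrite -(card_imset _ (can_inj swap_pairK)); congr #|pred_of_set _|.
apply/setP=> -[x y]; rewrite -(setD_tournament_arcC _ _ tA tB).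
by rewrite -[(x, y)]/(swap_pair (y, x)) (mem_imset _ _ (can_inj swap_pairK)).
Qed.

Lemma card_tournament A B :
  is_tournament A -> is_tournament B -> #|A| = #|B|.
Proof.
move=> tA tB; rewrite -(cardsID B A) -(cardsID A B) setIC.
by rewrite card_setD_tournamentC.
Qed.

Lemma sum_card_out A : \sum_x #|out A x| = #|A|.
Proof.
rewrite -sum1_card (eq_bigl (fun p => true && ((p.1, p.2) \in A))); last by case.
rewrite -(pair_big_dep predT (fun x y => (x, y) \in A) (fun=> fun=> 1)).
by apply: eq_bigr => x _; rewrite -sum1_card; apply: eq_bigl => y; rewrite inE.
Qed.

(** The scores sum to the number of arcs, which is the same for all tournaments
on [V]. *)
Lemma card_out_last_vertex A B v :
  is_tournament A -> is_tournament B ->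
  (forall x, x != v -> #|out A x| = #|out B x|) -> #|out A v| = #|out B v|.
Proof.
move=> tA tB eq_out; move/eqP: (card_tournament tA tB).
rewrite -!sum_card_out (bigD1 v) // [X in _ == X](bigD1 v) //=.
by rewrite (eq_bigr _ eq_out) eqn_add2r => /eqP.
Qed.

(** The reversal corrects [a -> b] and [b -> c]; the only arc it may spoil is
[c -> a], which becomes [a -> c]. *)
Lemma reverse_in_setD_shrink A B a b c :
  is_tournament A -> is_tournament B ->
  (a, b) \in A :\: B -> (b, c) \in A :\: B -> (c, a) \in A ->
  #|reverse_in [set a; b; c] A :\: B| < #|A :\: B|.
Proof.
move=> tA tB dab dbc ca.
have /andP[ab baB] : ((a, b) \in A) && ((b, a) \in B).
  by rewrite -setD_tournament_arc.
have /andP[bc cbB] : ((b, c) \in A) && ((c, b) \in B).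
  by rewrite -setD_tournament_arc.
have nabc : (a, b) != (b, c) by rewrite xpair_eqE (negPf (tournament_neq tA ab)).
apply: (card_setD_shrink dab dbc nabc); apply/subsetP=> -[u v].
rewrite in_setD in_reverse_in => /andP[].
case: ifP => [|out_uv nuvB uvA]; last first.
  rewrite !(in_setU1, in_setD1, in_setD) nuvB uvA !andbT.
  apply/orP; right; apply/andP; split; apply: contraFneq out_uv => -[-> ->];
    by rewrite !inE !eqxx ?orbT.
rewrite !inE -!orbA => /andP[/or3P[] /eqP-> /or3P[] /eqP->];
  by rewrite ?(tournament_irr _ tA) ?baB ?cbB ?eqxx
    ?(tournament_asym tA ab) ?(tournament_asym tA bc) ?(tournament_asym tA ca).
Qed.

(** Induction on the size of [A :\: B].  An arc path [a -> b -> c] of the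
difference without the chord [a -> c] yields a directed triangle in one of the
two tournaments; the orientation of [a, c] in [A] tells in which. *)
Lemma cycle_reversal_connect A B :
  is_tournament A -> is_tournament B -> (forall x, #|out A x| = #|out B x|) ->
  connect cycle_reversal A B.
Proof.
have [m] := ubnP #|A :\: B|; elim: m A B => // m IH A B leABm tA tB eq_out.
have [D0|[[x y] Dxy]] := set_0Vmem (A :\: B).
  by rewrite (setD_tournament_eq0 tA tB D0) connect0.
have [] := @intransitive_arcs [rel u v | (u, v) \in A :\: B] x y _ _ Dxy.
- by move=> u /=; rewrite in_setD (tournament_irr _ tA) andbF.
- by move=> u v; apply: setD_arc_next.
move=> a [b [c [/= dab dbc ndac]]].
have /andP[abA baB] : ((a, b) \in A) && ((b, a) \in B).
  by rewrite -setD_tournament_arc.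
have /andP[bcA cbB] : ((b, c) \in A) && ((c, b) \in B).
  by rewrite -setD_tournament_arc.
case: (boolP ((c, a) \in A)) => [ca|nca].
  have step : cycle_reversal A (reverse_in [set a; b; c] A).
    by apply/cycle_reversalP; split=> //; exists a, b, c; split=> //; apply/and3P.
  apply: connect_trans (connect1 step) (IH _ _ _ _ _ _) => //; last first.
  - by move=> z; rewrite (card_out_cycle_reversal z step).
  - exact: reverse_in_tournament.
  exact: leq_trans (reverse_in_setD_shrink tA tB dab dbc ca) _.
(* Both tournaments contain [a -> c], so [B] has the triangle to reverse. *)
have nca' : c != a.
  by apply: contraTneq bcA => ->; rewrite (tournament_asym tA abA).
have acB : (a, c) \in B.
  by move: ndac; rewrite in_setD (tournament_total tA nca' nca) andbT negbK.
have step : cycle_reversal B (reverse_in [set c; b; a] B).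
  by apply/cycle_reversalP; split=> //; exists c, b, a; split=> //; apply/and3P.
have tB' := reverse_in_tournament [set c; b; a] tB.
rewrite cycle_reversal_sym in step.
apply: connect_trans (IH _ _ _ _ _ _) (connect1 step) => //; last first.
  by move=> z; rewrite eq_out (card_out_cycle_reversal z step).
(* Seen from [B], the difference contains [c -> b -> a], so the shrinking
   lemma applies with the two tournaments exchanged. *)
rewrite -ltnS; apply: leq_trans leABm; rewrite ltnS card_setD_tournamentC //.
rewrite [leqRHS]card_setD_tournamentC //.
by apply: reverse_in_setD_shrink; rewrite -1?setD_tournament_arcC.
Qed.

End Tournaments.

(** * Loops as games against an extra player *)

Section LoopAsGame.
Variable n : nat.
Implicit Types (T : 'M[int]_n) (A : {set option 'I_n * option 'I_n}).

(** Entry [(i, j)] of a loopy tournament is the result of [Some i] against this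
player. *)
Definition opponent (i j : 'I_n) := if i == j then None else Some j.

Definition matrix_of_arcs A : 'M[int]_n :=
  \matrix_(i, j) ((Some i, opponent i j) \in A)%:R.

Definition arcs_of_matrix T : {set option 'I_n * option 'I_n} :=
  [set p | match p with
           | (Some i, Some j) => (i != j) && (T i j == 1)
           | (Some i, None) => T i i == 1
           | (None, Some i) => T i i == 0
           | (None, None) => false
           end].

Lemma opponent_inj i : injective (opponent i).
Proof.
by move=> j k; rewrite /opponent; case: eqP => [<-|_]; case: eqP => // _ [].
Qed.

(** The columns of row [i] enumerate the opponents of [Some i], that is, all
players but [Some i] itself, each once. *)
Lemma score_matrix_of_arcs A i :
  is_tournament A -> score_vector (matrix_of_arcs A) 0 i = #|out A (Some i)|%:R.
Proof.
move=> tA; rewrite mxE (eq_bigr (fun j => ((Some i, opponent i j) \in A)%:R));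
  last by move=> j _; rewrite mxE.
rewrite -natr_sum; congr (_%:R).
have -> : out A (Some i) = opponent i @: [set j | (Some i, opponent i j) \in A].
  apply/setP=> y; apply/idP/imsetP => [|[j]]; rewrite !inE; last by move=> ? ->.
  case: y => [j|] iy; last by exists i; rewrite ?inE /opponent eqxx.
  have nij : i != j.
    by apply: contraTneq iy => ->; rewrite (tournament_irr _ tA).
  by exists j; rewrite ?inE /opponent (negPf nij).
rewrite card_imset; last exact: opponent_inj.
by rewrite -sum1_card [RHS]big_mkcond; apply: eq_bigr => j _; rewrite inE; case: ifP.
Qed.

Lemma matrix_of_arcs_loopy A :
  is_tournament A -> loopy_tournament (matrix_of_arcs A).
Proof.
move/is_tournamentP=> tA; apply/andP; split.
  by apply/forallP=> i; apply/forallP=> j; rewrite mxE; case: (_ \in _).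
apply/forallP=> i; apply/forallP=> j; apply/implyP=> nij.
rewrite !mxE /opponent [j == i]eq_sym (negPf nij) tA.
rewrite (inj_eq Some_inj) nij /=.
by case: (_ \in A).
Qed.

Lemma loopy_tournamentP T :
  reflect [/\ forall i j, T i j = 0 \/ T i j = 1
            & forall i j, i != j -> T i j = 1 - T j i]
          (loopy_tournament T).
Proof.
apply: (iffP andP) => [[/'forall_forallP T01 /'forall_forallP asymT]|[T01 asymT]].
  split=> i j; last by move/implyP: (asymT i j) => aT /aT/eqP.
  by case/orP: (T01 i j) => /eqP; [left | right].
split; apply/'forall_forallP=> i j.
  by case: (T01 i j) => ->.
by apply/implyP=> /asymT->.
Qed.

Lemma arcs_of_matrix_tournament T :
  loopy_tournament T -> is_tournament (arcs_of_matrix T).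
Proof.
case/loopy_tournamentP=> T01 asymT; apply/is_tournamentP=> -[i|] [j|];
  rewrite !inE //=.
- rewrite (inj_eq Some_inj) [j == i]eq_sym.
  case: (eqVneq i j) => //= nij.
  by rewrite (asymT _ _ nij); case: (T01 j i) => ->.
- by case: (T01 i i) => ->.
- by case: (T01 j j) => ->.
Qed.

Lemma arcs_of_matrixK T :
  loopy_tournament T -> matrix_of_arcs (arcs_of_matrix T) = T.
Proof.
case/loopy_tournamentP=> T01 _; apply/matrixP=> i j; rewrite mxE /opponent.
case: eqVneq => [<-|nij]; rewrite inE ?nij.
  by case: (T01 i i) => ->.
by case: (T01 i j) => ->.
Qed.

Lemma matrix_of_arcs_offdiag A i j :
  i != j -> matrix_of_arcs A i j = ((Some i, Some j) \in A)%:R.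
Proof. by move=> nij; rewrite mxE /opponent (negPf nij). Qed.

Lemma matrix_of_arcs_diag A i :
  is_tournament A -> matrix_of_arcs A i i = ((None, Some i) \notin A)%:R.
Proof.
by move=> tA; rewrite mxE /opponent eqxx (is_tournamentP _ tA).
Qed.

(** * Triangle reversals are switches *)

Lemma cycle_switch_step_three_cycle A i j k :
  is_tournament A -> three_cycle A (Some i) (Some j) (Some k) ->
  cycle_switch_step (matrix_of_arcs A)
    (matrix_of_arcs (reverse_in [set Some i; Some j; Some k] A)).
Proof.
move=> tA /and3P[ij jk ki].
have nij : i != j by rewrite -(inj_eq Some_inj) (tournament_neq tA ij).
have njk : j != k by rewrite -(inj_eq Some_inj) (tournament_neq tA jk).
have nki : k != i by rewrite -(inj_eq Some_inj) (tournament_neq tA ki).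
have [nji nkj nik] : [/\ j != i, k != j & i != k] by split; rewrite eq_sym.
have neqs := (negPf nij, negPf njk, negPf nki, negPf nji, negPf nkj, negPf nik).
apply/existsP; exists i; apply/existsP; exists j; apply/existsP; exists k.
rewrite !matrix_of_arcs_offdiag // ij jk ki nij njk nki.
rewrite !(tournament_asym tA ij, tournament_asym tA jk, tournament_asym tA ki).
rewrite !eqxx /=; apply/eqP/matrixP=> u v; rewrite [RHS]mxE.
have [<-|nuv] := eqVneq u v.
  rewrite !inE !xpair_eqE.
  have -> : matrix_of_arcs (reverse_in [set Some i; Some j; Some k] A) u u
            = matrix_of_arcs A u u.
    by rewrite !mxE /opponent eqxx in_reverse_in !inE orbF andbF.
  have [->|nui] := eqVneq u i; first by rewrite !neqs.
  have [->|nuj] := eqVneq u j; first by rewrite !neqs.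
  by rewrite !andbF.
rewrite !matrix_of_arcs_offdiag // in_reverse_in.
rewrite !inE !xpair_eqE !(inj_eq Some_inj) /=.
have [eu|nui] := eqVneq u i.
  subst u; rewrite [v == i]eq_sym (negPf nuv) !neqs /=.
  have [->|nvj] := eqVneq v j; first by rewrite neqs (tournament_asym tA ij).
  by have [->|nvk] := eqVneq v k; rewrite ?ki.
have [eu|nuj] := eqVneq u j.
  subst u; rewrite [v == j]eq_sym (negPf nuv) !neqs /=.
  have [->|nvk] := eqVneq v k; first by rewrite neqs (tournament_asym tA jk).
  by have [->|nvi] := eqVneq v i; rewrite ?ij.
have [eu|nuk] := eqVneq u k.
  subst u; rewrite [v == k]eq_sym (negPf nuv) /=.
  have [->|nvi] := eqVneq v i; first by rewrite neqs (tournament_asym tA ki).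
  by have [->|nvj] := eqVneq v j; rewrite ?jk.
by [].
Qed.

Lemma edge_loop_switch_step_three_cycle A i j :
  is_tournament A -> three_cycle A (Some i) (Some j) None ->
  edge_loop_switch_step (matrix_of_arcs A)
    (matrix_of_arcs (reverse_in [set Some i; Some j; None] A)).
Proof.
move=> tA /and3P[ij j0 i0].
have nij : i != j by rewrite -(inj_eq Some_inj) (tournament_neq tA ij).
have tA' := reverse_in_tournament [set Some i; Some j; None] tA.
have nji : j != i by rewrite eq_sym.
apply/existsP; exists i; apply/existsP; exists j.
rewrite !matrix_of_arcs_diag // !matrix_of_arcs_offdiag //.
rewrite ij i0 nij (tournament_asym tA ij) (tournament_asym tA j0) /=.
apply/eqP/matrixP=> u v; rewrite [RHS]mxE.
rewrite !inE !xpair_eqE.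
have [<-|nuv] := eqVneq u v.
  rewrite !matrix_of_arcs_diag // in_reverse_in !inE (inj_eq Some_inj) !orbT orbF.
  have [->|nui] := eqVneq u i; first by rewrite (negPf nij) (tournament_asym tA i0).
  rewrite (inj_eq Some_inj); have [->|nuj] := eqVneq u j; last by [].
  by rewrite j0.
rewrite !matrix_of_arcs_offdiag // in_reverse_in !inE !(inj_eq Some_inj) !orbF.
have [eu|nui] := eqVneq u i.
  subst u; rewrite [v == i]eq_sym (negPf nuv) (negPf nij) /=.
  by have [->|nvj] := eqVneq v j; rewrite ?(tournament_asym tA ij).
have [eu|nuj] := eqVneq u j; last by [].
subst u; rewrite [v == j]eq_sym (negPf nuv) orbF /=.
by have [->|nvi] := eqVneq v i; rewrite ?ij.
Qed.

(** A directed triangle contains [None] at most once, and can be rotated so that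
[None] comes last. *)
Lemma switch_step_cycle_reversal A B :
  cycle_reversal A B -> switch_step (matrix_of_arcs A) (matrix_of_arcs B).
Proof.
case/cycle_reversalP=> tA [a [b [c [cA ->]]]]; apply/orP.
case: a b c cA => [i|] [j|] [k|] cA.
- by left; apply: cycle_switch_step_three_cycle.
- by right; apply: edge_loop_switch_step_three_cycle.
- right; rewrite -set3_rot; apply: edge_loop_switch_step_three_cycle => //.
  by rewrite three_cycle_rot.
- by case/and3P: cA => _; rewrite (tournament_irr _ tA).
- right; rewrite set3_rot; apply: edge_loop_switch_step_three_cycle => //.
  by rewrite -three_cycle_rot.
- by case/and3P: cA => _ _; rewrite (tournament_irr _ tA).
- by case/and3P: cA; rewrite (tournament_irr _ tA).
by case/and3P: cA; rewrite (tournament_irr _ tA).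
Qed.

Lemma path_switch_step A p :
  path (@cycle_reversal _) A p ->
  path (@switch_step n) (matrix_of_arcs A) (map matrix_of_arcs p).
Proof. exact/homo_path/switch_step_cycle_reversal. Qed.

Lemma path_cycle_reversal_loopy A p R :
  is_tournament A -> path (@cycle_reversal _) A p ->
  matrix_of_arcs A \in loopy_tournaments R ->
  all (fun T => T \in loopy_tournaments R) (map matrix_of_arcs p).
Proof.
elim: p A => //= B p IH A tA /andP[AB pB] AR.
have tB : is_tournament B.
  case/cycle_reversalP: AB => _ [a [b [c [_ ->]]]].
  exact: reverse_in_tournament.
have BR : matrix_of_arcs B \in loopy_tournaments R; last by rewrite BR (IH B).
rewrite inE matrix_of_arcs_loopy //=.
case/andP: AR => _ /eqP <-; apply/eqP/rowP=> i.
by rewrite !score_matrix_of_arcs // (card_out_cycle_reversal _ AB).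
Qed.

End LoopAsGame.

Theorem theorem8 (n : nat) (R : 'rV[int]_n) (T1 T2 : 'M[int]_n)
    (hT1 : T1 \in loopy_tournaments R) (hT2 : T2 \in loopy_tournaments R) :
  exists s : seq 'M[int]_n,
    [/\ path (@switch_step n) T1 s,
        all (fun T => T \in loopy_tournaments R) s
      & last T1 s = T2].
Proof.
have [/andP[l1 /eqP R1] /andP[l2 /eqP R2]] := (hT1, hT2).
have [t1 t2] := (arcs_of_matrix_tournament l1, arcs_of_matrix_tournament l2).
have eq_out i : #|out (arcs_of_matrix T1) (Some i)|
              = #|out (arcs_of_matrix T2) (Some i)|.
  apply/eqP; rewrite -eqz_nat -!natz -!score_matrix_of_arcs //.
  by rewrite !arcs_of_matrixK // R1 R2.
have eq_out' x : #|out (arcs_of_matrix T1) x| = #|out (arcs_of_matrix T2) x|.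
  case: x => // [].
  by apply: card_out_last_vertex => // -[].
have /connectP[p p1 p2] := cycle_reversal_connect t1 t2 eq_out'.
rewrite -(arcs_of_matrixK l1) -(arcs_of_matrixK l2) p2.
exists (map (@matrix_of_arcs n) p); split; last by rewrite last_map.
  exact: path_switch_step.
by apply: path_cycle_reversal_loopy p1 _; rewrite ?arcs_of_matrixK.
Qed.
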